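(* Let $\mathbb X$ be a deterministic $n\times p$ design matrix. Observe $\mathbf y=\mathbf f+\boldsymbol\xi$ where the random vector $\boldsymbol\xi\in\mathbf R^n$ satisfies $\mathbb E\exp(\alpha^T\boldsymbol\xi)\le\exp(\|\alpha\|_2^2K^2/2)$ for all $\alpha\in\mathbf R^n$, and let $K>0$ be the smallest positive number with this property. Let $\hat K$ be a given estimator and $\delta:=\mathbb P(\hat K^2<K^2)$. Then for all $x>0$, with probability at least $1-\delta-3e^{-x}$, the estimator $\hat{\boldsymbol\mu}_{\textsc{spa}}$ satisfies \[\|\hat{\boldsymbol\mu}_{\textsc{spa}}-\mathbf f\|_2^2\le\inf_{\boldsymbol\theta\in\mathbf R^p}\Big[\|\mathbb X\boldsymbol\theta-\mathbf f\|_2^2+31K^2x+(64\hat K^2+4K^2)\Big(\tfrac12+2\|\boldsymbol\theta\|_0\log\Big(\tfrac{ep}{1\vee\|\boldsymbol\theta\|_0}\Big)\Big)\Big].\]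
   Context: $\|\boldsymbol\theta\|_0$ is the number of nonzero coordinates. For each $J\subseteq\{1,\dots,p\}$, $A_J$ is the orthogonal projection matrix onto the span of the columns of $\mathbb X$ with indices in $J$ (so $A_J\mathbf y$ is the least squares estimator on that span). Weights: $\pi_J\propto e^{-|J|}\binom{p}{|J|}^{-1}$ normalized so that $\sum_J\pi_J=1$. Let $\Lambda=\{\boldsymbol\lambda=(\lambda_J)_{J\subseteq\{1,\dots,p\}}:\sum_J\lambda_J=1,\lambda_J\ge0\}$ and for $\boldsymbol\lambda\in\Lambda$, $\hat{\boldsymbol\mu}_{\boldsymbol\lambda}=\sum_J\lambda_JA_J\mathbf y$. Then $\hat{\boldsymbol\mu}_{\textsc{spa}}=\hat{\boldsymbol\mu}_{\hat{\boldsymbol\lambda}}$ where $\hat{\boldsymbol\lambda}$ minimizes over $\Lambda$ the function $\|\mathbf y-\hat{\boldsymbol\mu}_{\boldsymbol\lambda}\|_2^2+\sum_J\lambda_J\big(\frac12\|A_J\mathbf y-\hat{\boldsymbol\mu}_{\boldsymbol\lambda}\|_2^2+32\hat K^2\log\frac1{\pi_J}\big)$. *)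

(* Defs.v *)
From HB Require Import structures.
From Stdlib Require Import ClassicalEpsilon.
From mathcomp Require Import all_boot all_order all_algebra.
From mathcomp Require Import all_classical all_reals all_analysis.
Set Implicit Arguments. Unset Strict Implicit. Unset Printing Implicit Defensive.
Import Order.TTheory GRing.Theory Num.Theory.
Local Open Scope ring_scope.
Local Open Scope classical_set_scope.

Section Defs.
Context {R : realType}.

Definition sqnorm n (v : 'cV[R]_n) : R := \sum_(i < n) (v i 0) ^+ 2.

(* X with the columns outside J zeroed: its column span is the span of the
   columns of X indexed by J *)
Definition colsJ n p (X : 'M[R]_(n, p)) (J : {set 'I_p}) : 'M[R]_(n, p) :=
  X *m diag_mx (\row_j (if j \in J then 1 else 0)).

(* P is the orthogonal projection matrix onto the column span of B:
   symmetric, idempotent, and with column space equal to that of B *)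
Definition is_orth_proj n m (B : 'M[R]_(n, m)) (P : 'M[R]_n) : Prop :=
  P^T = P /\ P *m P = P /\ (P == B^T)%MS.

Definition projJ n p (X : 'M[R]_(n, p)) (J : {set 'I_p}) : 'M[R]_n :=
  epsilon (inhabits 0) (is_orth_proj (colsJ X J)).

Definition pi_unnorm p (J : {set 'I_p}) : R :=
  expR (- (#|J|%:R)) / ('C(p, #|J|))%:R.

Definition piJ p (J : {set 'I_p}) : R :=
  pi_unnorm J / \sum_(J' : {set 'I_p}) pi_unnorm J'.

Definition in_Lambda p (lam : {ffun {set 'I_p} -> R}) : Prop :=
  (forall J, 0 <= lam J) /\ \sum_(J : {set 'I_p}) lam J = 1.

Definition mu_lam n p (X : 'M[R]_(n, p)) (lam : {ffun {set 'I_p} -> R})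
  (y : 'cV[R]_n) : 'cV[R]_n :=
  \sum_(J : {set 'I_p}) lam J *: (projJ X J *m y).

Definition spa_obj n p (X : 'M[R]_(n, p)) (Khat : R) (y : 'cV[R]_n)
  (lam : {ffun {set 'I_p} -> R}) : R :=
  sqnorm (y - mu_lam X lam y)
  + \sum_(J : {set 'I_p}) lam J *
      (1/2 * sqnorm (projJ X J *m y - mu_lam X lam y)
       + 32 * Khat ^+ 2 * ln (1 / piJ J)).

Definition is_spa_weight n p (X : 'M[R]_(n, p)) (Khat : R) (y : 'cV[R]_n)
  (lam : {ffun {set 'I_p} -> R}) : Prop :=
  in_Lambda lam /\
  forall lam', in_Lambda lam' -> spa_obj X Khat y lam <= spa_obj X Khat y lam'.

Definition l0norm p (th : 'cV[R]_p) : nat := #|[set j | th j 0 != 0]|.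

Definition subgauss_mgf d (T : measurableType d) (P : probability T R) n
  (xi : T -> 'cV[R]_n) (K : R) : Prop :=
  forall alpha : 'cV[R]_n,
    (\int[P]_w (expR (\sum_(i < n) alpha i 0 * xi w i 0))%:E
      <= (expR (sqnorm alpha * K ^+ 2 / 2))%:E)%E.

End Defs.

(* Main.v *)
(* Moving the minimizer towards a vertex J gives the first-order condition
     |mu - f|^2 <= |A_J y - f|^2 + 32 Kh^2 L_J + sum_k lam_k *
       (2 <xi, (A_k - A_J) y> - |(A_k - A_J) y|^2 / 2 - 32 Kh^2 L_k),
   where L_J = ln (1 / pi_J).  With w = (A_k - A_J) f, the first two terms of
   the summand are at most
     2 |A_k xi|^2 + <xi, 2 w - (A_k - A_J) w> - |w|^2 / 2.
   The quadratic part is controlled by an exponential moment of |A_k xi|^2,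
   obtained from the sub-Gaussian assumption by integrating against an
   independent normal vector in the range of A_k; the linear part is controlled
   directly by the assumption, and half of |w|^2 absorbs its variance.  The
   prior pi makes both bounds uniform in J and k, at the price of L_J and L_k,
   and the terms in L_k are absorbed by the penalty when K^2 <= Kh^2.  Finally
   L_J <= 1/2 + 2 |J| ln (e p / |J|). *)
Require Import Defs.
From HB Require Import structures.
From mathcomp Require Import all_boot all_order all_algebra.
From mathcomp Require Import all_classical all_reals all_analysis.
From mathcomp Require Import measurable_realfun.
From mathcomp Require Import ring lra.
Set Implicit Arguments. Unset Strict Implicit. Unset Printing Implicit Defensive.
Import Order.TTheory GRing.Theory Num.Theory.
Local Open Scope ring_scope.
Local Open Scope classical_set_scope.

(** * Euclidean inner product on column vectors *)

Section InnerProduct.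
Context {R : realType}.
Implicit Types (n m : nat) (a : R).

Definition vdot n (u v : 'cV[R]_n) : R := \sum_(i < n) u i 0 * v i 0.

Lemma vdotE n (u v : 'cV[R]_n) : vdot u v = (u^T *m v) 0 0.
Proof. by rewrite /vdot mxE; apply: eq_bigr => i _; rewrite !mxE. Qed.

Lemma vdotC n (u v : 'cV[R]_n) : vdot u v = vdot v u.
Proof. by apply: eq_bigr => i _; rewrite mulrC. Qed.

Lemma vdotDl n (u v w : 'cV[R]_n) : vdot (u + v) w = vdot u w + vdot v w.
Proof. by rewrite !vdotE linearD mulmxDl mxE. Qed.

Lemma vdotZl n a (u w : 'cV[R]_n) : vdot (a *: u) w = a * vdot u w.
Proof. by rewrite !vdotE linearZ -scalemxAl mxE. Qed.

Lemma vdotNl n (u w : 'cV[R]_n) : vdot (- u) w = - vdot u w.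
Proof. by rewrite -scaleN1r vdotZl mulN1r. Qed.

Lemma vdotDr n (u v w : 'cV[R]_n) : vdot w (u + v) = vdot w u + vdot w v.
Proof. by rewrite vdotC vdotDl !(vdotC w). Qed.

Lemma vdotZr n a (u w : 'cV[R]_n) : vdot w (a *: u) = a * vdot w u.
Proof. by rewrite vdotC vdotZl (vdotC w). Qed.

Lemma vdotNr n (u w : 'cV[R]_n) : vdot w (- u) = - vdot w u.
Proof. by rewrite vdotC vdotNl (vdotC w). Qed.

Lemma vdot0r n (w : 'cV[R]_n) : vdot w 0 = 0.
Proof. by rewrite -(scale0r 0) vdotZr mul0r. Qed.

Lemma vdot_sumr n (I : finType) (F : I -> 'cV[R]_n) (w : 'cV[R]_n) :
  vdot w (\sum_i F i) = \sum_i vdot w (F i).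
Proof.
by rewrite vdotE mulmx_sumr summxE; apply: eq_bigr => i _; rewrite vdotE.
Qed.

Lemma vdot_mulmx n m (A : 'M[R]_(n, m)) (u : 'cV[R]_n) (v : 'cV[R]_m) :
  vdot u (A *m v) = vdot (A^T *m u) v.
Proof. by rewrite !vdotE trmx_mul trmxK mulmxA. Qed.

Lemma sqnormE n (v : 'cV[R]_n) : sqnorm v = vdot v v.
Proof. by []. Qed.

Definition vdotW n := (@vdotDl n, @vdotDr n, @vdotZl n, @vdotZr n, @vdotNl n, @vdotNr n).

Lemma sqnorm_ge0 n (v : 'cV[R]_n) : 0 <= sqnorm v.
Proof. by apply: sumr_ge0 => i _; exact: sqr_ge0. Qed.

Lemma sqnorm_eq0 n (v : 'cV[R]_n) : sqnorm v = 0 -> v = 0.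
Proof.
move=> /eqP; rewrite psumr_eq0 => [/allP h|i _]; last exact: sqr_ge0.
apply/colP => i; have := h i; rewrite mem_index_enum mxE => /(_ isT) /=.
by rewrite sqrf_eq0 => /eqP.
Qed.

Lemma sqnormZ n a (v : 'cV[R]_n) : sqnorm (a *: v) = a ^+ 2 * sqnorm v.
Proof. by rewrite !sqnormE !vdotW mulrA. Qed.

Lemma sqnormD_le n (u v : 'cV[R]_n) :
  sqnorm (u + v) <= 2 * sqnorm u + 2 * sqnorm v.
Proof.
have := sqnorm_ge0 (u - v); rewrite !sqnormE !vdotW (vdotC v u); lra.
Qed.

End InnerProduct.

(** * Orthogonal projections as symmetric idempotent matrices *)

Section OrthogonalProjections.
Context {R : realType}.
Implicit Types n m : nat.

Section SymmetricIdempotent.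
Variables (n : nat) (P : 'M[R]_n).
Hypotheses (Psym : P^T = P) (Pidem : P *m P = P).

Lemma vdot_proj (u v : 'cV[R]_n) : vdot u (P *m v) = vdot (P *m u) v.
Proof. by rewrite vdot_mulmx Psym. Qed.

Lemma sqnorm_projE (v : 'cV[R]_n) : sqnorm (P *m v) = vdot v (P *m v).
Proof. by rewrite sqnormE -vdot_proj mulmxA Pidem. Qed.

Lemma sqnorm_proj_le (v : 'cV[R]_n) : sqnorm (P *m v) <= sqnorm v.
Proof.
have := sqnorm_ge0 (v - P *m v); have := sqnorm_projE v.
rewrite !sqnormE !vdotW (vdotC (P *m v) v); lra.
Qed.

Lemma proj_closest (v w : 'cV[R]_n) : P *m w = w ->
  sqnorm (P *m v - v) <= sqnorm (w - v).
Proof.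
move=> Pw; have := sqnorm_ge0 (w - P *m v); have := sqnorm_projE v.
have : vdot w (P *m v) = vdot w v by rewrite vdot_proj Pw.
rewrite !sqnormE !vdotW (vdotC (P *m v) v) (vdotC v w) (vdotC (P *m v) w); lra.
Qed.

(** Pythagoras: [P *m f - f] lies in the kernel of [P], and [P *m xi] in its range. *)
Lemma sqnorm_proj_noise (f xi : 'cV[R]_n) :
  sqnorm (P *m (f + xi) - f) = sqnorm (P *m f - f) + sqnorm (P *m xi).
Proof.
have h : vdot (P *m f - f) (P *m xi) = 0.
  by rewrite vdot_proj mulmxBr mulmxA Pidem subrr vdotC vdot0r.
rewrite mulmxDr addrAC; move: (P *m f - f) (P *m xi) h => u v h.
by rewrite !sqnormE vdotDl !vdotDr (vdotC v u) h addr0 add0r.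
Qed.

(** A normalised nonzero column of [P] serves as [u]. Since [P - u *m u^T] kills [u] and its row
    space lies in that of [P], the rank drops; this drives the induction in [subgauss_proj_mgf]. *)
Lemma proj_split : P != 0 -> exists u : 'cV[R]_n,
  [/\ sqnorm u = 1, P *m u = u,
      (P - u *m u^T)^T = P - u *m u^T,
      (P - u *m u^T) *m (P - u *m u^T) = P - u *m u^T &
      (\rank (P - u *m u^T)%R < \rank P)%N].
Proof.
move=> P0; have [j Pj] : exists j, col j P != 0.
  apply/existsP; apply: contraNT P0 => /existsPn h; apply/eqP/matrixP => i j.
  by have := h j; rewrite negbK => /eqP /colP /(_ i); rewrite !mxE.
set s := sqnorm (col j P).
have s0 : 0 < s.
  by rewrite lt_neqAle sqnorm_ge0 andbT; apply: contra Pj => /eqP/esym/sqnorm_eq0 ->.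
set u := (Num.sqrt s)^-1 *: col j P.
have u1 : sqnorm u = 1.
  by rewrite sqnormZ exprVn sqr_sqrtr ?mulVf ?gt_eqF// ltW.
have Pu : P *m u = u by rewrite /u colE -scalemxAr mulmxA Pidem.
have uP : u^T *m P = u^T by rewrite -{1}Psym -trmx_mul Pu.
have uu : u^T *m u = 1%:M by rewrite [LHS]mx11_scalar -vdotE -sqnormE u1.
set Q := P - u *m u^T; exists u; split => //.
- by rewrite /Q linearB /= trmx_mul trmxK Psym.
- rewrite /Q mulmxBl !mulmxBr Pidem mulmxA Pu -!mulmxA uP.
  by rewrite (mulmxA u^T) uu mul1mx subrr subr0.
have QP : Q *m P = Q by rewrite /Q mulmxBl Pidem -mulmxA uP.
have Qu : Q *m u = 0 by rewrite /Q mulmxBl Pu -mulmxA uu mulmx1 subrr.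
have lePQ : (Q <= P)%MS by rewrite -QP submxMl.
rewrite ltn_neqAle mxrankS // andbT; apply/negP => /eqP rk.
have PQ : (P <= Q)%MS by rewrite -(geq_leqif (mxrank_leqif_sup lePQ)) rk.
have : P *m u = 0 by case/submxP: PQ => D ->; rewrite -mulmxA Qu mulmx0.
by rewrite Pu => u0; move: u1; rewrite u0 sqnormE vdot0r => /eqP; rewrite eq_sym oner_eq0.
Qed.

End SymmetricIdempotent.

(** When the rows of [M] form a basis of the column span of [B], the projection is
    [M^T (M M^T)^-1 M]. Existence makes the [epsilon] in [projJ] satisfy its specification. *)
Lemma orth_proj_exists n m (B : 'M[R]_(n, m)) : exists P, is_orth_proj B P.
Proof.
have [k [M [Mfree MB]]] : exists k (M : 'M[R]_(k, n)), row_free M /\ (M :=: B^T)%MS.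
  by exists (\rank B^T), (row_base B^T); split; [exact: row_base_free|exact: eq_row_base].
(* If [v M M^T = 0] then [|v M|^2 = 0], and freeness of [M] gives [v = 0]. *)
have MMu : M *m M^T \in unitmx.
  rewrite -row_free_unit -kermx_eq0; apply/rowV0P => v /sub_kermxP vM.
  apply/eqP; rewrite -(mulmx_free_eq0 _ Mfree) -trmx_eq0; apply/eqP/sqnorm_eq0.
  by rewrite sqnormE vdotE trmxK trmx_mul -mulmxA (mulmxA M) (mulmxA v) vM mul0mx mxE.
set P := M^T *m invmx (M *m M^T) *m M.
have PM : M *m P = M by rewrite /P !mulmxA mulmxV// mul1mx.
exists P; split; last split.
- by rewrite /P !trmx_mul trmxK trmx_inv trmx_mul trmxK mulmxA.
- by rewrite {1}/P -mulmxA PM.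
- by rewrite -MB submxMl /= -MB -{1}PM submxMl.
Qed.

Variables (n p : nat) (X : 'M[R]_(n, p)) (J : {set 'I_p}).

Lemma projJP : is_orth_proj (colsJ X J) (projJ X J).
Proof. exact: ClassicalEpsilon.epsilon_spec (orth_proj_exists _). Qed.

Lemma projJ_sym : (projJ X J)^T = projJ X J.
Proof. by have [] := projJP. Qed.

Lemma projJ_idem : projJ X J *m projJ X J = projJ X J.
Proof. by have [_ []] := projJP. Qed.

(** The diagonal selector of [J] is a sum of [#|J|] matrices of rank one. *)
Lemma rank_projJ : (\rank (projJ X J) <= #|J|)%N.
Proof.
have [_ [_ /eqmxP ->]] := projJP.
rewrite mxrank_tr; apply: leq_trans (mxrankM_maxr _ _) _.
have -> : diag_mx (\row_j (if j \in J then 1 else 0)) =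
    \sum_(j in J) delta_mx j j :> 'M[R]_p.
  rewrite diag_mx_sum_delta [RHS]big_mkcond; apply: eq_bigr => j _.
  by rewrite mxE; case: ifP; rewrite ?scale1r ?scale0r.
rewrite -sum1_card; elim/big_rec2: _ => [|j m A _ IH]; first by rewrite mxrank0.
by apply: leq_trans (mxrank_add _ _) _; rewrite mxrank_delta leq_add2l.
Qed.

Lemma projJ_support (th : 'cV[R]_p) :
  (forall j, th j 0 != 0 -> j \in J) -> projJ X J *m (X *m th) = X *m th.
Proof.
move=> supp; have -> : X *m th = colsJ X J *m th.
  rewrite /colsJ -mulmxA; congr (_ *m _); apply/colP => j.
  rewrite mul_diag_mx !mxE; case: ifP => [_|/negP jJ]; first by rewrite mul1r.
  by rewrite mul0r; apply/eqP/negPn/negP => /supp.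
rewrite mulmxA; congr (_ *m _).
have [_ [_ /andP[_ /submxP[D hD]]]] := projJP.
by rewrite -[colsJ X J]trmxK hD trmx_mul projJ_sym mulmxA projJ_idem.
Qed.

End OrthogonalProjections.

(** * Minimisation of the Q-aggregation objective over the simplex *)

Section QAggregation.
Context {R : realType}.
Variables (n : nat) (I : finType) (a : I -> 'cV[R]_n) (q : I -> R).

Definition agg (lam : {ffun I -> R}) : 'cV[R]_n := \sum_i lam i *: a i.

(** With [a k = projJ X k *m y] and [q k = 32 * Khat ^+ 2 * ln (1 / piJ k)] this is convertible to
    [spa_obj]. *)
Definition qobj (y : 'cV[R]_n) (lam : {ffun I -> R}) : R :=
  sqnorm (y - agg lam)
  + \sum_i lam i * (1 / 2 * sqnorm (a i - agg lam) + q i).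

Definition simplex (lam : {ffun I -> R}) : Prop :=
  (forall i, 0 <= lam i) /\ \sum_i lam i = 1.

Definition toward (lam : {ffun I -> R}) (t : R) (j : I) : {ffun I -> R} :=
  [ffun k => (1 - t) * lam k + t * (k == j)%:R].

Lemma sum_toward lam t j (F : I -> R) :
  \sum_k toward lam t j k * F k = (1 - t) * (\sum_k lam k * F k) + t * F j.
Proof.
under eq_bigr do rewrite ffunE mulrDl -!mulrA.
rewrite big_split /= -!mulr_sumr; congr (_ + _ * _).
rewrite (bigD1 j)//= eqxx mul1r big1 ?addr0// => i /negbTE ->.
by rewrite mul0r.
Qed.

Lemma simplex_toward lam t j : simplex lam -> 0 <= t <= 1 ->
  simplex (toward lam t j).
Proof.
move=> [l0 l1] /andP[t0 t1]; split=> [i|].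
  by rewrite ffunE addr_ge0 // mulr_ge0 // subr_ge0.
have e (m : {ffun I -> R}) : \sum_k m k = \sum_k m k * 1.
  by apply: eq_bigr => k _; rewrite mulr1.
by rewrite e sum_toward -e l1; ring.
Qed.

Lemma agg_toward lam t j : agg (toward lam t j) = agg lam + t *: (a j - agg lam).
Proof.
have -> : agg (toward lam t j) = (1 - t) *: agg lam + t *: a j.
  apply/colP => i; rewrite /agg !mxE !summxE.
  under eq_bigr do rewrite mxE; rewrite sum_toward.
  by congr (_ * _ + _); apply: eq_bigr => k _; rewrite mxE.
by rewrite scalerBl scale1r scalerBr -addrA; congr (_ + _); rewrite addrC.
Qed.

Lemma sum_vdot_centered lam (w : 'cV[R]_n) : simplex lam ->
  \sum_i lam i * vdot w (a i - agg lam) = 0.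
Proof.
move=> [_ l1]; under eq_bigr do rewrite -vdotZr scalerBr.
by rewrite -vdot_sumr sumrB -scaler_suml l1 scale1r subrr vdot0r.
Qed.

(** Bias-variance identity: the cross term vanishes because [a i - agg lam] has [lam]-average
    zero. *)
Lemma sum_sqnorm_centered lam (z : 'cV[R]_n) : simplex lam ->
  \sum_i lam i * sqnorm (a i - agg lam - z)
  = \sum_i lam i * sqnorm (a i - agg lam) + sqnorm z.
Proof.
move=> lamP; have [_ l1] := lamP.
have -> : \sum_i lam i * sqnorm (a i - agg lam - z) =
    \sum_i (lam i * sqnorm (a i - agg lam)
            - 2 * (lam i * vdot z (a i - agg lam)) + lam i * sqnorm z).
  apply: eq_bigr => i _; move: (a i - agg lam) => v.
  by rewrite !sqnormE !vdotW (vdotC v z); ring.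
by rewrite big_split sumrB /= -mulr_sumr sum_vdot_centered // -mulr_suml l1;
   ring.
Qed.

(** Along a segment the objective is exactly quadratic, so the coefficient of [t] is its directional
    derivative at [lam]. *)
Lemma qobj_toward y lam t j : simplex lam ->
  let e := a j - agg lam in
  qobj y (toward lam t j) = qobj y lam
   + t * (- 2 * vdot (y - agg lam) e + 1 / 2 * sqnorm e
          - 1 / 2 * (\sum_i lam i * sqnorm (a i - agg lam))
          + q j - \sum_i lam i * q i)
   + t ^+ 2 * (1 / 2 * sqnorm e).
Proof.
move=> lamP e; rewrite /qobj agg_toward sum_toward -/e.
have split_pen (z : 'cV[R]_n) : \sum_i lam i * (1 / 2 * sqnorm (a i - z) + q i)
    = 1 / 2 * (\sum_i lam i * sqnorm (a i - z)) + \sum_i lam i * q i.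
  by rewrite mulr_sumr -big_split; apply: eq_bigr => i _ /=; ring.
rewrite !split_pen.
have -> : \sum_i lam i * sqnorm (a i - (agg lam + t *: e))
    = \sum_i lam i * sqnorm (a i - agg lam) + sqnorm (t *: e).
  by rewrite -sum_sqnorm_centered//; apply: eq_bigr => i _; rewrite opprD addrA.
have -> : a j - (agg lam + t *: e) = (1 - t) *: e.
  by rewrite opprD addrA -/e scalerBl scale1r.
have -> : y - (agg lam + t *: e) = y - agg lam - t *: e by rewrite opprD addrA.
clearbody e; move: (y - agg lam) (\sum_i _ * sqnorm _) => z V.
by rewrite !sqnormZ !sqnormE !vdotW (vdotC e z); field.
Qed.

Lemma ge0_of_quadratic (b c : R) : (forall t, 0 <= t <= 1 -> 0 <= t * b + t ^+ 2 * c) ->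
  0 <= b.
Proof.
move=> h; rewrite leNgt; apply/negP => b0.
have c0 : 0 < c by have := h 1; rewrite !mul1r ler01 lexx expr1n => /(_ isT); lra.
(* This [t] lies in the unit interval and turns [b + t * c] into [- b ^+ 2 / (c - b)], which is
   negative. *)
pose t := - b / (c - b).
have cb : 0 < c - b by lra.
have tI : 0 <= t <= 1.
  apply/andP; split; first by rewrite divr_ge0// ?oppr_ge0 ltW.
  by rewrite /t ler_pdivrMr// mul1r; lra.
have := h _ tI.
rewrite (_ : t * b + t ^+ 2 * c = t * (b + t * c)); last by ring.
have -> : b + t * c = - b ^+ 2 / (c - b) by rewrite /t; field; rewrite gt_eqF.
move=> h'.
have t0 : 0 < t by rewrite divr_gt0// oppr_gt0.
have : t * (- b ^+ 2 / (c - b)) < 0.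
  rewrite pmulr_rlt0// mulNr oppr_lt0 divr_gt0// exprn_even_gt0//=.
  by rewrite lt_eqF.
lra.
Qed.

(* The first-order condition at the minimizer, in the direction of the vertex j. *)
Lemma qagg_oracle y f lam j : simplex lam ->
  (forall lam', simplex lam' -> qobj y lam <= qobj y lam') ->
  sqnorm (agg lam - f) <= sqnorm (a j - f) + q j
    + \sum_i lam i * (2 * vdot (y - f) (a i - a j)
                      - 1 / 2 * sqnorm (a i - a j) - q i).
Proof.
move=> lamP lam_min; set e := a j - agg lam.
set D := - 2 * vdot (y - agg lam) e + 1 / 2 * sqnorm e
          - 1 / 2 * (\sum_i lam i * sqnorm (a i - agg lam))
          + q j - \sum_i lam i * q i.
have D0 : 0 <= D.
  apply: (@ge0_of_quadratic _ (1 / 2 * sqnorm e)) => t tI.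
  have := lam_min _ (simplex_toward j lamP tI).
  by rewrite (qobj_toward y t j lamP) -/e -/D; lra.
have [_ l1] := lamP.
(* Recentring by [a i - a j = (a i - agg lam) - e] makes the linear sum vanish and splits the
   quadratic one. *)
have -> : \sum_i lam i * (2 * vdot (y - f) (a i - a j)
                      - 1 / 2 * sqnorm (a i - a j) - q i) =
   2 * (\sum_i lam i * vdot (y - f) (a i - agg lam)) - 2 * vdot (y - f) e
   - 1 / 2 * (\sum_i lam i * sqnorm (a i - agg lam - e)) - \sum_i lam i * q i.
  have sumc z : \sum_i lam i * z = z by rewrite -mulr_suml l1 mul1r.
  rewrite -[2 * vdot (y - f) e]sumc [2 * \sum_i lam i * _]mulr_sumr.
  rewrite [1 / 2 * \sum_i lam i * _]mulr_sumr -!sumrB.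
  apply: eq_bigr => i _.
  have -> : a i - agg lam - e = a i - a j by rewrite /e opprB addrA subrK.
  have -> : vdot (y - f) (a i - a j) = vdot (y - f) (a i - agg lam) - vdot (y - f) e.
    by rewrite -vdotNr -vdotDr /e opprB addrA subrK.
  by ring.
rewrite sum_vdot_centered// sum_sqnorm_centered//.
have -> : a j - f = e + (agg lam - f) by rewrite /e addrA subrK.
move: D0; rewrite /D.
have -> : y - agg lam = (y - f) - (agg lam - f) by rewrite opprB addrA subrK.
clearbody e; move: (y - f) (agg lam - f) (\sum_i _ * sqnorm _) => u v V.
rewrite !sqnormE !vdotW (vdotC e v); lra.
Qed.

End QAggregation.

(** * The sparsity prior and its logarithm *)

Section SparsityPrior.
Context {R : realType}.
Variable p : nat.
Implicit Types J : {set 'I_p}.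

Local Notation Z := (\sum_(J : {set 'I_p}) pi_unnorm (R := R) J).

Lemma bin_card_gt0 J : (0 < 'C(p, #|J|)%:R :> R).
Proof. by rewrite ltr0n bin_gt0 -[leqRHS]card_ord max_card. Qed.

Lemma pi_unnorm_gt0 J : 0 < pi_unnorm (R := R) J.
Proof. by rewrite divr_gt0// ?expR_gt0// bin_card_gt0. Qed.

(** The ['C(p, k)] sets of size [k] cancel the binomial in the weight, which leaves a geometric
    sum. *)
Lemma sum_pi_unnormE : Z = \sum_(k < p.+1) expR (- 1) ^+ k.
Proof.
rewrite (partition_big (fun J : {set 'I_p} => inord #|J| : 'I_p.+1) predT)//=.
apply: eq_bigr => k _.
have inordE J : (inord #|J| == k) = (#|J| == k).
  by rewrite -val_eqE /= inordK // ltnS -[leqRHS]card_ord max_card.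
under eq_bigl do rewrite inordE.
rewrite (eq_bigr (fun=> expR (- k%:R) / 'C(p, k)%:R)); last first.
  by move=> J /eqP cJ; rewrite /pi_unnorm cJ.
rewrite sumr_const.
have -> : #|[pred J : {set 'I_p} | #|J| == k]| = 'C(p, k).
  have := card_draws 'I_p k; rewrite card_ord => <-.
  by apply: eq_card => J; rewrite !inE.
rewrite -[_ *+ _]mulr_natr mulfVK; first by rewrite -expRM_natr mulN1r.
by rewrite pnatr_eq0 -lt0n bin_gt0 -ltnS.
Qed.

Lemma sum_pi_unnorm_ge1 : 1 <= Z.
Proof.
rewrite sum_pi_unnormE big_ord_recl expr0 lerDl; apply: sumr_ge0 => i _.
by rewrite exprn_ge0// expR_ge0.
Qed.

(* [1 / (1 - e^-1) <= e^(1/2)] amounts to [2 sinh (1/2) >= 1]. *)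
Lemma sum_pi_unnorm_le : Z <= expR (1 / 2).
Proof.
set h : R := expR (1 / 2); set hi : R := expR (- (1 / 2)).
have hhi : h * hi = 1 by rewrite -expRD subrr expR0.
have q1 : expR (- 1) = hi ^+ 2 :> R by rewrite expr2 -expRD; congr expR; lra.
(* Any lower bound above the golden ratio yields [h - 1 / h >= 1]. The eighth power of
   [17 / 16 <= expR (1 / 16)] gives slightly more than [1.62]. *)
have h162 : 162 / 100 <= h.
  have h16 : 17 / 16 <= expR (1 / 16) :> R by have := expR_ge1Dx (1 / 16 : R); lra.
  have -> : h = expR (1 / 16) ^+ 8 by rewrite -expRM_natr; congr expR; lra.
  have h8 : (17 / 16) ^+ 8 <= expR (1 / 16) ^+ 8 :> R.
    by rewrite lerXn2r ?nnegrE ?expR_ge0 ?divr_ge0.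
  by apply: le_trans h8; lra.
have hi0 : 0 < hi by exact: expR_gt0.
have sinh1 : 1 <= h - hi.
  have : hi * (162 / 100) <= 1 by rewrite -[leRHS]hhi mulrC ler_pM2r.
  lra.
have geo : (1 - hi ^+ 2) * Z <= 1.
  rewrite sum_pi_unnormE q1 -opprB mulNr -subrX1 opprB gerBl.
  by rewrite exprn_ge0// sqr_ge0.
have hi1 : hi ^+ 2 < 1 by rewrite -q1 expR_lt1; lra.
rewrite -(@ler_pM2l _ (1 - hi ^+ 2)) ?subr_gt0//; apply: le_trans geo _.
by rewrite mulrBl mul1r expr2 -mulrA (mulrC hi h) hhi mulr1.
Qed.

Lemma ln_inv_piJ J :
  ln (1 / piJ J) = #|J|%:R + ln ('C(p, #|J|)%:R : R) + ln Z.
Proof.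
have Z0 : 0 < Z by exact: lt_le_trans ltr01 sum_pi_unnorm_ge1.
have C0 := bin_card_gt0 J.
rewrite div1r /piJ invf_div /pi_unnorm invf_div mulrA !lnM ?posrE ?invr_gt0 ?mulr_gt0 ?expR_gt0//.
  by rewrite lnV ?posrE ?expR_gt0// expRK opprK; lra.
Qed.

Lemma piJ_gt0 J : 0 < piJ (R := R) J.
Proof.
by rewrite divr_gt0 ?pi_unnorm_gt0//; exact: lt_le_trans ltr01 sum_pi_unnorm_ge1.
Qed.

Lemma sum_piJ : \sum_(J : {set 'I_p}) piJ J = 1 :> R.
Proof.
rewrite -mulr_suml mulfV// gt_eqF//.
exact: lt_le_trans ltr01 sum_pi_unnorm_ge1.
Qed.

(** Both the binomial and the normaliser are at least 1. Thus the logarithm of the prior can pay for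
    the dimension [#|J|]. *)
Lemma ln_inv_piJ_ge J : #|J|%:R <= ln (1 / piJ (R := R) J).
Proof.
rewrite ln_inv_piJ -addrA lerDl addr_ge0// ln_ge0//; last exact: sum_pi_unnorm_ge1.
by rewrite ler1n -(ltr0n R) bin_card_gt0.
Qed.

(** Combines ['C(p, k) * k! <= p ^ k] with [k ^ k <= k! * e ^ k], the latter from a single term of
    the exponential series. *)
Lemma ln_bin_le (k : nat) : (0 < k <= p)%N ->
  ln ('C(p, k)%:R) <= k%:R * ln (expR 1 * p%:R / k%:R) :> R.
Proof.
move=> /andP[k0 kp].
have kR : 0 < k%:R :> R by rewrite ltr0n.
have pR : 0 < p%:R :> R by rewrite ltr0n (leq_trans k0).
have CR : 0 < 'C(p, k)%:R :> R by rewrite ltr0n bin_gt0.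
have fR : 0 < k`!%:R :> R by rewrite ltr0n fact_gt0.
rewrite mulr_natl -lnXn ?divr_gt0 ?mulr_gt0 ?expR_gt0//.
rewrite ler_ln ?posrE ?exprn_gt0 ?divr_gt0 ?mulr_gt0 ?expR_gt0//.
have Cf : 'C(p, k)%:R * k`!%:R <= p%:R ^+ k :> R.
  rewrite -natrM bin_ffact -natrX ler_nat.
  by rewrite ffact_prod -[in leqRHS](card_ord k) -prod_nat_const leq_prod// => i _; exact: leq_subr.
have kk : k%:R ^+ k <= k`!%:R * expR 1 ^+ k :> R.
  rewrite -expRM_natr mul1r mulrC -ler_pdivrMr//.
  by have := @expR_ge1Dxn R k%:R k.-1 (ltW kR); rewrite prednK//; lra.
rewrite expr_div_n exprMn ler_pdivlMr ?exprn_gt0//.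
rewrite (le_trans (ler_wpM2l (ltW CR) kk))// mulrA mulrC.
by rewrite ler_wpM2l// exprn_ge0// expR_ge0.
Qed.

(** The normaliser costs [1 / 2]. For nonempty [J] the factor [2] covers the log-binomial together
    with the [#|J|] of the exponential weight, since [ln (e p / #|J|) >= 1]. *)
Lemma ln_inv_piJ_le J : ln (1 / piJ (R := R) J) <=
  1 / 2 + 2 * #|J|%:R * ln (expR 1 * p%:R / (maxn 1 #|J|)%:R).
Proof.
have lnZ : ln Z <= 1 / 2.
  rewrite -[leRHS]expRK ler_ln ?posrE ?expR_gt0 ?sum_pi_unnorm_le//.
  exact: lt_le_trans ltr01 sum_pi_unnorm_ge1.
rewrite ln_inv_piJ; have [J0|J0] := posnP #|J|.
  by rewrite J0 bin0 ln1 mulr0 mul0r !add0r addr0.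
rewrite (maxn_idPr J0).
have Jp : (0 < #|J| <= p)%N by rewrite J0 -[leqRHS]card_ord max_card.
have JR : 0 < #|J|%:R :> R by rewrite ltr0n.
have pJ : 1 <= ln (expR 1 * p%:R / #|J|%:R) :> R.
  rewrite -[leLHS]expRK ler_ln ?posrE ?expR_gt0 ?divr_gt0 ?mulr_gt0 ?expR_gt0//.
    by rewrite ler_pdivlMr// ler_pM2l ?expR_gt0// ler_nat; case/andP: Jp.
  by rewrite ltr0n; case/andP: Jp => a; exact: leq_trans a.
have := ln_bin_le Jp; have : #|J|%:R <= #|J|%:R * ln (expR 1 * p%:R / #|J|%:R) :> R.
  by rewrite ler_peMr// ltW.
lra.
Qed.

End SparsityPrior.

(** * Two exponential moments of the standard normal law *)

Section GaussianIntegrals.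
Context {R : realType}.
Local Notation leb := (@lebesgue_measure R).
Local Notation phi := (@normal_pdf R 0 1).

(** Completing the square turns the integrand into [expR (m ^+ 2 / 2)] times the normal density of
    mean [m]. *)
Lemma integral_normal_pdf_expRM (m : R) :
  (\int[leb]_g (phi g * expR (m * g))%:E = (expR (m ^+ 2 / 2))%:E)%E.
Proof.
have e g : (phi g * expR (m * g))%:E
    = ((expR (m ^+ 2 / 2))%:E * (normal_pdf m 1 g)%:E)%E.
  rewrite -EFinM; congr EFin; rewrite !normal_pdfE ?oner_neq0// /normal_fun.
  rewrite -mulrA -expRD mulrCA -expRD; congr (_ * expR _).
  by rewrite expr1n; field.
under eq_integral do rewrite e.
rewrite ge0_integralZl_EFin ?expR_ge0//.
- by rewrite integral_normal_pdf mule1.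
- by move=> g _; rewrite lee_fin normal_pdf_ge0.
- by apply/measurable_EFinP; exact: measurable_normal_pdf.
Qed.

(* [1/2 - 8/25 = 1 / (2 (5/3)^2)], so the integrand is 5/3 times the density
   of the centered normal law with standard deviation 5/3. *)
Lemma integral_normal_pdf_expR_sqr :
  (\int[leb]_g (phi g * expR (8 / 25 * g ^+ 2))%:E = (5 / 3)%:E)%E.
Proof.
have peak : normal_peak (1 : R) = 5 / 3 * normal_peak (5 / 3).
  rewrite /normal_peak expr1n mul1r -mulrnAr sqrtrM ?sqr_ge0// sqrtr_sqr.
  by rewrite ger0_norm ?divr_ge0// invfM mulrA mulfV ?mul1r//.
have e g : (phi g * expR (8 / 25 * g ^+ 2))%:E
    = ((5 / 3)%:E * (normal_pdf 0 (5 / 3) g)%:E)%E.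
  rewrite -EFinM; congr EFin; rewrite !normal_pdfE ?oner_neq0//.
  rewrite peak /normal_fun -!mulrA -expRD; congr (_ * (_ * (_ * expR _))).
  by rewrite expr1n; field.
under eq_integral do rewrite e.
rewrite ge0_integralZl_EFin ?divr_ge0//.
- by rewrite integral_normal_pdf mule1.
- by move=> g _; rewrite lee_fin normal_pdf_ge0.
- by apply/measurable_EFinP; exact: measurable_normal_pdf.
Qed.

End GaussianIntegrals.

(** * Exponential moments of projected sub-Gaussian noise *)

Section SubGaussian.
Context {R : realType} (d : measure_display) (T : measurableType d).
Variables (P : probability T R) (n : nat) (xi : T -> 'cV[R]_n) (K : R).
Hypothesis mxi : forall i : 'I_n, measurable_fun setT (fun w => xi w i 0).
Hypotheses (K0 : 0 < K) (xiP : subgauss_mgf P xi K).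

Local Notation leb := (@lebesgue_measure R).
Local Notation phi := (@normal_pdf R 0 1).

Lemma measurable_vdot (alpha : 'cV[R]_n) :
  measurable_fun setT (fun w => vdot alpha (xi w)).
Proof. by apply: measurable_sum => i; exact: measurable_funM. Qed.

Lemma measurable_sqnorm_mulmx m (A : 'M[R]_(m, n)) :
  measurable_fun setT (fun w => sqnorm (A *m xi w)).
Proof.
apply: measurable_sum => i; apply: measurable_funX.
by under eq_fun do rewrite mxE; apply: measurable_sum => j; exact: measurable_funM.
Qed.

Lemma subgauss_vdot (alpha : 'cV[R]_n) :
  (\int[P]_w (expR (vdot alpha (xi w)))%:E
    <= (expR (sqnorm alpha * K ^+ 2 / 2))%:E)%E.
Proof. exact: xiP. Qed.

(* Each unit direction u of the range is integrated against an independent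
   standard normal g: exp (c^2 <u, xi>^2 / 2) = E_g exp (c g <u, xi>), which
   tilts alpha by c g u and lowers the rank by one.  The value c = 4 / (5 K)
   keeps all constants rational. *)
Lemma subgauss_proj_mgf r (A : 'M[R]_n) (alpha : 'cV[R]_n) :
  A^T = A -> A *m A = A -> (\rank A <= r)%N -> A *m alpha = 0 ->
  (\int[P]_w (expR (8 / (25 * K ^+ 2) * sqnorm (A *m xi w)
                    + vdot alpha (xi w)))%:E
    <= ((5 / 3) ^+ r * expR (sqnorm alpha * K ^+ 2 / 2))%:E)%E.
Proof.
(* The zero matrix occurs both at the base of the induction and with rank bound to spare;
   [5 / 3 >= 1] absorbs the excess. *)
have trivial_case s b : (\int[P]_w (expR (8 / (25 * K ^+ 2) * sqnorm ((0 : 'M[R]_n) *m xi w)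
      + vdot b (xi w)))%:E <= ((5 / 3) ^+ s * expR (sqnorm b * K ^+ 2 / 2))%:E)%E.
  under eq_integral do rewrite mul0mx sqnormE vdot0r mulr0 add0r.
  apply: le_trans (subgauss_vdot b) _.
  by rewrite lee_fin ler_peMl ?expR_ge0// exprn_ege1//; lra.
elim: r A alpha => [|r IH] A alpha As Ai rk Aalpha.
  by move: rk; rewrite leqn0 mxrank_eq0 => /eqP ->; exact: trivial_case.
have [->|A0] := eqVneq A 0; first exact: trivial_case.
have [u [u1 Au Qs Qi rkQ]] := proj_split As Ai A0.
set Q := A - u *m u^T in Qs Qi rkQ.
(* The tilted vector stays in the kernel of [Q], as the induction hypothesis demands. *)
have Q_alpha g : Q *m (alpha + g *: u) = 0.
  have ua : u^T *m alpha = 0.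
    by rewrite -Au trmx_mul As -mulmxA Aalpha mulmx0.
  have uu : u^T *m u = 1%:M by rewrite [LHS]mx11_scalar -vdotE -sqnormE u1.
  rewrite /Q mulmxBl !mulmxDr -!scalemxAr Aalpha Au -!mulmxA ua uu.
  by rewrite mulmx1 mulmx0 !add0r subrr.
have ualpha : vdot u alpha = 0.
  by rewrite -Au -(vdot_proj As) Aalpha vdot0r.
have rkQ' : (\rank Q <= r)%N by rewrite -ltnS (leq_trans rkQ).
have sqA v : sqnorm (A *m v) = sqnorm (Q *m v) + vdot u v ^+ 2.
  rewrite (sqnorm_projE As Ai) (sqnorm_projE Qs Qi) /Q mulmxBl vdotDr vdotNr.
  have -> : vdot v (u *m u^T *m v) = vdot u v ^+ 2.
    rewrite -mulmxA [u^T *m v]mx11_scalar -vdotE mul_mx_scalar vdotZr.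
    by rewrite (vdotC v) expr2.
  by rewrite subrK.
set s := 8 / (25 * K ^+ 2); set c := 4 / (5 * K).
have Kn0 : K != 0 by rewrite gt_eqF.
(* Joint integrand of the noise and the auxiliary normal variable; it is nonnegative, so Tonelli
   allows integrating over the noise first. *)
pose F (z : T * R) : \bar R := (phi z.2 *
  expR (s * sqnorm (Q *m xi z.1) + vdot (alpha + (c * z.2) *: u) (xi z.1)))%:E.
have F0 z : (0 <= F z)%E by rewrite lee_fin mulr_ge0 ?normal_pdf_ge0 ?expR_ge0.
have mF : measurable_fun setT F.
  apply/measurable_EFinP; apply: measurable_funM.
    by apply: measurableT_comp; [exact: measurable_normal_pdf|exact: measurable_snd].
  apply: measurableT_comp => //; apply: measurable_funD.
    apply: measurable_funM => //.
    exact: (measurableT_comp (measurable_sqnorm_mulmx Q) measurable_fst).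
  under eq_fun do rewrite vdotDl vdotZl.
  apply: measurable_funD.
    exact: (measurableT_comp (measurable_vdot alpha) measurable_fst).
  apply: measurable_funM.
    by apply: measurable_funM => //; exact: measurable_snd.
  exact: (measurableT_comp (measurable_vdot u) measurable_fst).
have -> : (\int[P]_w (expR (s * sqnorm (A *m xi w) + vdot alpha (xi w)))%:E
    = \int[P]_w \int[leb]_g F (w, g))%E.
  apply: eq_integral => w _.
  have e g : F (w, g) = ((expR (s * sqnorm (Q *m xi w) + vdot alpha (xi w)))%:E
      * (phi g * expR (c * vdot u (xi w) * g))%:E)%E.
    rewrite -EFinM /F /= mulrCA -expRD; congr (_ * expR _)%:E.
    by rewrite vdotDl vdotZl; ring.
  under eq_integral do rewrite e.
  rewrite ge0_integralZl_EFin ?expR_ge0//.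
  - rewrite integral_normal_pdf_expRM -EFinM -expRD sqA; congr (expR _)%:E.
    by rewrite /s /c; field.
  - by move=> g _; rewrite lee_fin mulr_ge0 ?normal_pdf_ge0 ?expR_ge0.
  - apply/measurable_EFinP; apply: measurable_funM; first exact: measurable_normal_pdf.
    by apply: measurableT_comp => //; exact: measurable_funM.
rewrite (@fubini_tonelli _ _ _ _ _ P leb F mF F0).
set b := (5 / 3) ^+ r * expR (sqnorm alpha * K ^+ 2 / 2).
have b0 : 0 <= b by rewrite mulr_ge0 ?expR_ge0// exprn_ge0// divr_ge0.
have mphi : measurable_fun setT (fun g => (phi g * expR (8 / 25 * g ^+ 2))%:E).
  apply/measurable_EFinP; apply: measurable_funM; first exact: measurable_normal_pdf.
  by apply: measurableT_comp => //; apply: measurable_funM => //; exact: measurable_funX.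
(* For fixed [g] the induction hypothesis bounds the integral over the noise. As [u] is a unit
   vector orthogonal to [alpha], the tilt adds [c^2 g^2 K^2 / 2 = 8 / 25 * g ^+ 2] to the exponent;
   integrating over [g] then gives the factor [5 / 3]. *)
apply: (@le_trans _ _ (\int[leb]_g (b%:E * (phi g * expR (8 / 25 * g ^+ 2))%:E))%E).
  apply: ge0_le_integral => //.
  - by move=> g _; apply: integral_ge0.
  - exact: (measurable_fun_fubini_tonelli_G F).
  - by apply: measurable_funeM.
  move=> g _; rewrite /F /=.
  under eq_integral do rewrite EFinM.
  rewrite ge0_integralZl_EFin ?normal_pdf_ge0//; last first.
    apply/measurable_EFinP; apply: measurableT_comp => //; apply: measurable_funD.
      by apply: measurable_funM => //; exact: measurable_sqnorm_mulmx.
    exact: measurable_vdot.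
  apply: (@le_trans _ _ ((phi g)%:E * ((5 / 3) ^+ r *
      expR (sqnorm (alpha + (c * g) *: u) * K ^+ 2 / 2))%:E)%E).
    by apply: lee_wpmul2l; [rewrite lee_fin normal_pdf_ge0|exact: IH].
  have -> : sqnorm (alpha + (c * g) *: u) * K ^+ 2 / 2
      = sqnorm alpha * K ^+ 2 / 2 + 8 / 25 * g ^+ 2.
    move: u1; rewrite !sqnormE !vdotW (vdotC alpha u) ualpha => ->.
    by rewrite /c; field.
  rewrite -!EFinM expRD le_eqVlt; apply/orP; left; apply/eqP; congr EFin.
  by rewrite /b; ring.
rewrite ge0_integralZl_EFin//; last first.
  by move=> g _; rewrite lee_fin mulr_ge0 ?normal_pdf_ge0 ?expR_ge0.
by rewrite integral_normal_pdf_expR_sqr -EFinM /b mulrC mulrA -exprS.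
Qed.

End SubGaussian.

(** * Chernoff bound, uniform over a weighted family *)

Section WeightedChernoff.
Context {R : realType} (d : measure_display) (T : measurableType d).
Variables (P : probability T R) (I : finType) (wt : I -> R) (Y : I -> T -> R).
Hypotheses (wt0 : forall i, 0 < wt i) (wt1 : \sum_i wt i = 1).
Hypothesis mY : forall i, measurable_fun setT (Y i).
Hypothesis Y1 : forall i, (\int[P]_w (expR (Y i w))%:E <= 1)%E.

(** Markov's inequality is applied once, to the mixture [\sum_i wt i * expR (Y i w)] of mean at most
    1. Each summand is below the mixture, so index [i] pays only [ln (1 / wt i)]. *)
Lemma weighted_chernoff (x : R) : exists B : set T,
  [/\ measurable B, (P B <= (expR (- x))%:E)%E &
      forall w, ~ B w -> forall i, Y i w <= x + ln (1 / wt i)].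
Proof.
pose G w := \sum_i wt i * expR (Y i w).
have G0 w : 0 <= G w by apply: sumr_ge0 => i _; rewrite mulr_ge0 ?expR_ge0// ltW.
have mG : measurable_fun setT G.
  by apply: measurable_sum => i; apply: measurable_funM => //; exact: measurableT_comp.
have EG : (\int[P]_w (G w)%:E <= 1)%E.
  under eq_integral do rewrite -sumEFin.
  rewrite ge0_integral_sum//; last 2 first.
  - by move=> i; apply/measurable_EFinP; apply: measurable_funM => //; exact: measurableT_comp.
  - by move=> i w _; rewrite lee_fin mulr_ge0 ?expR_ge0// ltW.
  rewrite -[leRHS]/(1%:E) -wt1 -sumEFin; apply: lee_sum => i _.
  under eq_integral do rewrite EFinM.
  have wi : 0 <= wt i by exact: ltW.
  rewrite ge0_integralZl_EFin//; last first.
    by apply/measurable_EFinP; exact: measurableT_comp.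
  apply: (@le_trans _ _ ((wt i)%:E * 1)%E); last by rewrite mule1.
  by apply: lee_wpmul2l; rewrite // lee_fin ltW.
exists [set w | expR x <= G w]; split.
- have -> : [set w | expR x <= G w] = setT `&` G @^-1` `[expR x, +oo[.
    by rewrite setTI; apply/seteqP; split => w /=; rewrite in_itv /= andbT.
  exact: mG.
- set B := [set w | _].
  have markov : ((expR x)%:E * P B <= 1)%E.
    apply: le_trans EG.
    have -> : B = setT `&` [set w | ((expR x)%:E <= `|(G w)%:E|)%E].
      by rewrite setTI; apply/seteqP; split => w /=; rewrite ger0_norm// lee_fin.
    rewrite [leRHS](_ : _ = \int[P]_w `|(G w)%:E|)%E; last first.
      by apply: eq_integral => w _; rewrite /= ger0_norm.
    by apply: le_integral_abse => //; [exact/measurable_EFinP|exact: expR_gt0].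
  have -> : P B = ((expR (- x))%:E * ((expR x)%:E * P B))%E.
    by rewrite muleA -EFinM -expRD addNr expR0 mul1e.
  apply: (@le_trans _ _ ((expR (- x))%:E * 1)%E); last by rewrite mule1.
  by apply: lee_wpmul2l; rewrite // lee_fin expR_ge0.
move=> w /negP; rewrite -ltNge => Gx i.
have : wt i * expR (Y i w) <= expR x.
  apply: le_trans (ltW Gx); rewrite /G (bigD1 i)//= lerDl.
  by apply: sumr_ge0 => j _; rewrite mulr_ge0 ?expR_ge0// ltW.
rewrite -{1}(lnK (wt0 i)) -expRD ler_expR div1r lnV ?posrE//.
lra.
Qed.

End WeightedChernoff.

(** * Deterministic risk bound, given control of the noise *)

Section SpaRisk.
Context {R : realType} (n p : nat).
Variable X : 'M[R]_(n, p).
Implicit Types (f xi : 'cV[R]_n) (J k : {set 'I_p}).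

Local Notation A := (projJ X).

Definition diffJ J k f : 'cV[R]_n := (A k - A J) *m f.

Definition tilt J k f : 'cV[R]_n := 2 *: diffJ J k f - diffJ J k (diffJ J k f).

(** Expand with [B = A k - A J]. The terms [- 2 |A J xi|^2] and [- |B xi|^2 / 2] are dropped, and
    symmetry of [B] moves the cross term into [tilt]. *)
Lemma projJ_noise_le f xi J k :
  2 * vdot xi (A k *m (f + xi) - A J *m (f + xi))
    - 1 / 2 * sqnorm (A k *m (f + xi) - A J *m (f + xi))
  <= 2 * sqnorm (A k *m xi) + vdot (tilt J k f) xi - 1 / 2 * sqnorm (diffJ J k f).
Proof.
rewrite -mulmxBl /tilt /diffJ; set B := A k - A J; rewrite mulmxDr.
have Bs : B^T = B by rewrite /B linearB /= !projJ_sym.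
have quad : vdot xi (B *m xi) <= sqnorm (A k *m xi).
  rewrite (sqnorm_projE (projJ_sym X k) (projJ_idem X k)) /B mulmxBl vdotDr vdotNr.
  rewrite -(sqnorm_projE (projJ_sym X J) (projJ_idem X J)).
  by rewrite lerBlDr lerDl sqnorm_ge0.
have := sqnorm_ge0 (B *m xi); move: quad.
rewrite !sqnormE !vdotW (vdotC (B *m xi) (B *m f)) (vdot_mulmx B (B *m f) xi) Bs.
rewrite (vdotC (B *m f) xi); lra.
Qed.

(** With [B = A k - A J], [|2 w - B w|^2 <= 8 |w|^2 + 2 |B w|^2], and [|B w|^2 <= 4 |w|^2] because
    projections contract. *)
Lemma sqnorm_tilt_le J k f : sqnorm (tilt J k f) <= 16 * sqnorm (diffJ J k f).
Proof.
rewrite /tilt; move: (diffJ J k f) => w; rewrite /diffJ.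
have sqN (v : 'cV[R]_n) : sqnorm (- v) = sqnorm v.
  by rewrite -scaleN1r sqnormZ sqrrN expr1n mul1r.
have := sqnormD_le (2 *: w) (- ((A k - A J) *m w)); rewrite sqN sqnormZ mulmxBl.
have := sqnormD_le (A k *m w) (- (A J *m w)); rewrite sqN.
have := sqnorm_proj_le (projJ_sym X k) (projJ_idem X k) w.
have := sqnorm_proj_le (projJ_sym X J) (projJ_idem X J) w.
lra.
Qed.

(* [l0norm] counts a classical set; the prior is indexed by finite sets. *)
Lemma l0normE (th : 'cV[R]_p) : l0norm th = #|[set j | th j 0 != 0]%SET|.
Proof.
by apply: eq_card => j; rewrite inE; apply/idP/idP => [/set_mem|h]; last exact: mem_set.
Qed.

Lemma sqnorm_projJ_support f (th : 'cV[R]_p) :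
  sqnorm (A [set j | th j 0 != 0]%SET *m f - f) <= sqnorm (X *m th - f).
Proof.
apply: proj_closest; [exact: projJ_sym|exact: projJ_idem|].
by apply: projJ_support => j; rewrite inE.
Qed.

Lemma spa_risk_le f xi (K Kh x : R) (lam : {ffun {set 'I_p} -> R})
    (th : 'cV[R]_p) :
  0 < x -> K ^+ 2 <= Kh ^+ 2 ->
  (forall J, sqnorm (A J *m xi) <= 25 / 8 * K ^+ 2 * (x + 2 * ln (1 / piJ J))) ->
  (forall J k, vdot (tilt J k f) xi <=
      1 / 2 * sqnorm (diffJ J k f)
      + 16 * K ^+ 2 * (x + (ln (1 / piJ J) + ln (1 / piJ k)))) ->
  is_spa_weight X Kh (f + xi) lam ->
  sqnorm (mu_lam X lam (f + xi) - f)
    <= sqnorm (X *m th - f) + 31 * K ^+ 2 * x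
       + (64 * Kh ^+ 2 + 4 * K ^+ 2)
         * (1 / 2 + 2 * (l0norm th)%:R
              * ln (expR 1 * p%:R / (maxn 1 (l0norm th))%:R)).
Proof.
move=> x0 KKh chi lin [lamP lam_min].
pose L J : R := ln (1 / piJ J).
have L0 J : 0 <= L J by apply: le_trans (ln_inv_piJ_ge J).
have K20 : 0 <= K ^+ 2 by exact: sqr_ge0.
set J := [set j | th j 0 != 0]%SET.
have := @qagg_oracle R n _ (fun k => A k *m (f + xi))
  (fun k => 32 * Kh ^+ 2 * L k) (f + xi) f lam J lamP lam_min.
rewrite -/(mu_lam X lam (f + xi)) (sqnorm_proj_noise (projJ_sym X J) (projJ_idem X J)).
set S := \sum_i _ => oracle.
(* In units of [K ^+ 2], the quadratic part gives [25 / 4 * (x + 2 * L k)] and the linear part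
   [16 * (x + L J + L k)]. The total [57 / 2] in front of [L k] is below the [32] of the penalty. *)
have SE : S <= 89 / 4 * (K ^+ 2 * x) + 16 * (K ^+ 2 * L J).
  have [l0 l1] := lamP.
  rewrite -[leRHS]mul1r -[X in _ <= X * _]l1 mulr_suml; apply: ler_sum => k _.
  rewrite ler_wpM2l//.
  have -> : f + xi - f = xi by rewrite addrC addKr.
  have := projJ_noise_le f xi J k; have := chi k; have := lin J k.
  rewrite -/(L J) -/(L k).
  have : K ^+ 2 * L k <= Kh ^+ 2 * L k by rewrite ler_wpM2r.
  have : 0 <= K ^+ 2 * L k by rewrite mulr_ge0.
  lra.
(* The noise [|A J xi|^2] adds [25 / 8 * (x + 2 * L J)] in the same units. The coefficient of [x]
   becomes [203 / 8 <= 31], and that of [L J], namely [32 Kh^2 + 89 / 4 K^2], is at most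
   [64 Kh^2 + 4 K^2]. *)
have := chi J; rewrite -/(L J).
have := sqnorm_projJ_support f th; rewrite -/J.
have : 0 <= K ^+ 2 * x by rewrite mulr_ge0// ltW.
have : K ^+ 2 * L J <= Kh ^+ 2 * L J by rewrite ler_wpM2r.
have : 0 <= K ^+ 2 * L J by rewrite mulr_ge0.
have : (64 * Kh ^+ 2 + 4 * K ^+ 2) * L J <= (64 * Kh ^+ 2 + 4 * K ^+ 2)
         * (1 / 2 + 2 * (l0norm th)%:R
              * ln (expR 1 * p%:R / (maxn 1 (l0norm th))%:R)).
  apply: ler_wpM2l; last by rewrite l0normE; exact: ln_inv_piJ_le.
  by rewrite addr_ge0// mulr_ge0// sqr_ge0.
set bnd := (_ + _) * (_ + _); lra.
Qed.

End SpaRisk.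

(** * Uniform events for the quadratic and linear parts of the noise *)

Section SubGaussianEvents.
Context {R : realType} (d : measure_display) (T : measurableType d).
Variables (P : probability T R) (n p : nat) (X : 'M[R]_(n, p)).
Variables (xi : T -> 'cV[R]_n) (K : R).
Hypothesis mxi : forall i : 'I_n, measurable_fun setT (fun w => xi w i 0).
Hypotheses (K0 : 0 < K) (xiP : subgauss_mgf P xi K).

Let Kn0 : K != 0. Proof. by rewrite gt_eqF. Qed.

(** Subtracting [#|J|] in the exponent compensates the moment bound [(5 / 3) ^+ #|J|], as
    [5 / 3 <= e]. Adding it back costs at most another [ln (1 / piJ J)], hence the factor [2]. *)
Lemma projJ_chi2_event (x : R) : exists B : set T,
  [/\ measurable B, (P B <= (expR (- x))%:E)%E &
      forall w, ~ B w -> forall J, sqnorm (projJ X J *m xi w)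
        <= 25 / 8 * K ^+ 2 * (x + 2 * ln (1 / piJ J))].
Proof.
pose Y (J : {set 'I_p}) w :=
  8 / (25 * K ^+ 2) * sqnorm (projJ X J *m xi w) - #|J|%:R.
have mY J : measurable_fun setT (Y J).
  apply: measurable_funB => //; apply: measurable_funM => //.
  exact: measurable_sqnorm_mulmx.
have Y1 J : (\int[P]_w (expR (Y J w))%:E <= 1)%E.
  have mgf := subgauss_proj_mgf mxi K0 xiP (projJ_sym X J) (projJ_idem X J)
    (rank_projJ X J) (mulmx0 _ _).
  under eq_integral do rewrite expRD mulrC EFinM.
  rewrite ge0_integralZl_EFin ?expR_ge0//; last first.
    apply/measurable_EFinP; apply: measurableT_comp => //; apply: measurable_funM => //.
    exact: measurable_sqnorm_mulmx.
  have -> : (\int[P]_w (expR (8 / (25 * K ^+ 2) * sqnorm (projJ X J *m xi w)))%:E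
      = \int[P]_w (expR (8 / (25 * K ^+ 2) * sqnorm (projJ X J *m xi w)
                         + vdot 0 (xi w)))%:E)%E.
    by apply: eq_integral => w _; rewrite vdotC vdot0r addr0.
  apply: (@le_trans _ _ ((expR (- #|J|%:R))%:E * ((5 / 3) ^+ #|J|)%:E)%E).
    apply: lee_wpmul2l; first by rewrite lee_fin expR_ge0.
    by apply: le_trans mgf _; rewrite sqnormE vdot0r !mul0r expR0 mulr1.
  rewrite -EFinM lee_fin -[#|J|%:R]mul1r -mulNr expRM_natr -exprMn exprn_ile1//.
  by rewrite expRN ler_pdivrMl ?expR_gt0// mulr1; have := expR_ge1Dx (1 : R); lra.
have [B [mB PB hB]] := weighted_chernoff (@piJ_gt0 R p) (sum_piJ p) mY Y1 x.
exists B; split => // w /hB h J.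
have := h J; have := ln_inv_piJ_ge (R := R) J; rewrite /Y; set s := sqnorm _ => hJ hs.
have K2 : 0 < 8 / (25 * K ^+ 2) by rewrite divr_gt0// mulr_gt0// exprn_gt0.
rewrite -(ler_pM2l K2).
have -> : 8 / (25 * K ^+ 2) * (25 / 8 * K ^+ 2 * (x + 2 * ln (1 / piJ J)))
    = x + 2 * ln (1 / piJ J) by field.
lra.
Qed.

(** The Chernoff bound runs over pairs [(J, k)] with product weights, so the two logarithms add. *)
Lemma tilt_event (f : 'cV[R]_n) (x : R) : exists B : set T,
  [/\ measurable B, (P B <= (expR (- x))%:E)%E &
      forall w, ~ B w -> forall J k, vdot (tilt X J k f) (xi w) <=
        1 / 2 * sqnorm (diffJ X J k f)
        + 16 * K ^+ 2 * (x + (ln (1 / piJ J) + ln (1 / piJ k)))].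
Proof.
(* With [w = diffJ X J k f] and [|tilt|^2 <= 16 |w|^2], this scale makes the variance term
   [c^2 |tilt|^2 K^2 / 2] at most [c * |w|^2 / 2]. *)
pose c : R := (16 * K ^+ 2)^-1.
pose al (i : {set 'I_p} * {set 'I_p}) := c *: tilt X i.1 i.2 f.
pose Y i w := vdot (al i) (xi w) - sqnorm (al i) * K ^+ 2 / 2.
have mY i : measurable_fun setT (Y i).
  by apply: measurable_funB => //; exact: measurable_vdot.
have Y1 i : (\int[P]_w (expR (Y i w))%:E <= 1)%E.
  under eq_integral do rewrite expRD mulrC EFinM.
  rewrite ge0_integralZl_EFin ?expR_ge0//; last first.
    by apply/measurable_EFinP; apply: measurableT_comp => //; exact: measurable_vdot.
  apply: (@le_trans _ _ ((expR (- (sqnorm (al i) * K ^+ 2 / 2)))%:E *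
      (expR (sqnorm (al i) * K ^+ 2 / 2))%:E)%E).
    by apply: lee_wpmul2l; [rewrite lee_fin expR_ge0|exact: subgauss_vdot].
  by rewrite -EFinM -expRD addNr expR0.
pose wt (i : {set 'I_p} * {set 'I_p}) : R := piJ i.1 * piJ i.2.
have wt0 i : 0 < wt i by rewrite mulr_gt0// piJ_gt0.
have wt1 : \sum_i wt i = 1.
  rewrite -(pair_bigA _ (fun J k => piJ J * piJ k)) /=.
  under eq_bigr do rewrite -mulr_sumr sum_piJ mulr1.
  exact: sum_piJ.
have [B [mB PB hB]] := weighted_chernoff wt0 wt1 mY Y1 x.
exists B; split => // w /hB h J k.
have := h (J, k); have := sqnorm_tilt_le X J k f.
have -> : ln (1 / wt (J, k)) = ln (1 / piJ J) + ln (1 / piJ k).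
  have pJ := piJ_gt0 (R := R) J; have pk := piJ_gt0 (R := R) k.
  by rewrite /wt /= !div1r invfM lnM ?posrE ?invr_gt0.
rewrite /Y /al /= sqnormZ vdotZl; set L := _ + ln _; set s := sqnorm _; set v := vdot _ _.
have c0 : 0 < c by rewrite invr_gt0 mulr_gt0// exprn_gt0.
have eL : c * (16 * K ^+ 2 * (x + L)) = x + L by rewrite /c; field.
move=> hs hv; rewrite -(ler_pM2l c0) mulrDr eL.
have e : c ^+ 2 * s * K ^+ 2 / 2 = c * (s / 32) by rewrite /c; field.
have : c * (s / 32) <= c * (1 / 2 * sqnorm (diffJ X J k f)) by rewrite ler_pM2l//; lra.
lra.
Qed.

End SubGaussianEvents.

(** * Union bound over the exceptional events *)

Theorem theorem7p3 (R : realType) (d : measure_display) (T : measurableType d)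
  (P : probability T R) (n p : nat) (X : 'M[R]_(n, p)) (f : 'cV[R]_n)
  (xi : T -> 'cV[R]_n) (K : R) (Khat : 'cV[R]_n -> R) :
  (forall i : 'I_n, measurable_fun setT (fun w => xi w i 0)) ->
  0 < K -> subgauss_mgf P xi K ->
  (forall K' : R, 0 < K' -> subgauss_mgf P xi K' -> K <= K') ->
  measurable [set w | Khat (f + xi w) ^+ 2 < K ^+ 2] ->
  forall x : R, 0 < x ->
  exists A : set T,
    measurable A /\
    A `<=` [set w | forall lam : {ffun {set 'I_p} -> R},
              is_spa_weight X (Khat (f + xi w)) (f + xi w) lam ->
              forall th : 'cV[R]_p,
                sqnorm (mu_lam X lam (f + xi w) - f)
                <= sqnorm (X *m th - f) + 31 * K ^+ 2 * x
                   + (64 * Khat (f + xi w) ^+ 2 + 4 * K ^+ 2)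
                     * (1 / 2 + 2 * (l0norm th)%:R
                          * ln (expR 1 * p%:R / (maxn 1 (l0norm th))%:R))] /\
    ((1 - fine (P [set w | Khat (f + xi w) ^+ 2 < K ^+ 2]) - 3 * expR (- x))%:E
      <= P A)%E.
Proof.
move=> mxi K0 xiP _ mD x x0; set D := [set w | _] in mD *.
have [B1 [mB1 PB1 hB1]] := projJ_chi2_event X mxi K0 xiP x.
have [B2 [mB2 PB2 hB2]] := tilt_event X mxi K0 xiP f x.
have mBD : measurable (D `|` (B1 `|` B2)) by do 2 apply: measurableU => //.
(* This event is fixed before the weights and [th], so the bound holds for all of them
   simultaneously. Off [D], [K ^+ 2] is at most the squared estimator. *)
exists (~` (D `|` (B1 `|` B2))); split; first exact: measurableC.
split.
  move=> w /= /not_orP[/negP Dw /not_orP[nB1 nB2]] lam lamP th.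
  apply: (spa_risk_le th x0 _ (hB1 w nB1) (hB2 w nB2) lamP).
  by rewrite leNgt.
rewrite probability_setC//.
have PD : P D = (fine (P D))%:E by rewrite fineK// fin_num_measure.
have PU : (P (D `|` (B1 `|` B2)) <= (fine (P D) + (expR (- x) + expR (- x)))%:E)%E.
  apply: le_trans (measureU2 _ _ _) _ => //; first exact: measurableU.
  rewrite EFinD -PD; apply: leeD => //.
  apply: le_trans (measureU2 _ _ _) _ => //.
  by rewrite EFinD; apply: leeD.
apply: (@le_trans _ _ (1 - (fine (P D) + (expR (- x) + expR (- x)))%:E)%E).
  (* The union bound spends [2 * expR (- x)]; positivity of the exponential covers the passage to
     [3 * expR (- x)]. *)
  by rewrite -EFinB lee_fin; have := expR_gt0 (- x); lra.
exact: leeB.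
Qed.
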